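(* Let $p$ and $q$ be prime numbers with $p<q$ and $p \equiv q \equiv 3 \pmod 4$. Then $$\kappa(pq) \equiv 1 + \left(\frac{q}{p}\right) \pmod 4,$$ where $\left(\frac{q}{p}\right)$ is the Legendre symbol.
   Context: A real quadratic number is a real irrational root $w$ of a quadratic polynomial with integer coefficients; $w'$ denotes its algebraic conjugate over $\mathbb{Q}$. The discriminant $\mathrm{disc}(w)$ of $w$ is $b^2-4ac$, where $aw^2+bw+c=0$ with $a,b,c\in\mathbb{Z}$, $a>0$, $\gcd(a,b,c)=1$. A real quadratic number $w$ is reduced if $w>1$ and $-1<w'<0$. For a positive non-square integer $D$, $\kappa(D)$ denotes the (finite) number of reduced real quadratic numbers $w$ with $\mathrm{disc}(w)=D$. *)

(* Defs.v *)
From HB Require Import structures.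
From mathcomp Require Import all_boot all_order all_algebra finmap.
From mathcomp Require Import all_classical reals.
From mathcomp Require Import ring lra zify.

Set Implicit Arguments.
Unset Strict Implicit.
Unset Printing Implicit Defensive.

Import Order.TTheory GRing.Theory Num.Theory.

Local Open Scope classical_set_scope.
Local Open Scope ring_scope.

Definition real_quadratic (R : realType) (w : R) : Prop :=
  irrational w /\
  exists P : {poly int}, size P = 3 /\ root (map_poly intr P) w.

(* [w'] is an algebraic conjugate of [w] over Q, different from [w]; for a
   real quadratic number there is exactly one, see [conjugateP]. *)
Definition conjugate (R : realType) (w w' : R) : Prop :=
  w' <> w /\
  exists P : {poly rat},
    [/\ irreducible_poly P, root (map_poly ratr P) w
      & root (map_poly ratr P) w'].

Definition primitive_eq (R : realType) (w : R) (a b c : int) : Prop :=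
  [/\ 0 < a, gcdz (gcdz a b) c = 1
    & a%:~R * w ^+ 2 + b%:~R * w + c%:~R = 0].

(* disc(w) = D, as a relation; [has_disc_uniq] shows that it is functional. *)
Definition has_disc (R : realType) (w : R) (D : int) : Prop :=
  exists a b c : int, primitive_eq w a b c /\ D = b ^+ 2 - 4 * a * c.

Definition reduced (R : realType) (w : R) : Prop :=
  [/\ real_quadratic w, 1 < w
    & exists w' : R, conjugate w w' /\ -1 < w' < 0].

Definition reduced_of_disc (R : realType) (D : nat) : set R :=
  [set w | reduced w /\ has_disc w D%:Z].

(* [fset_set] is only meaningful on finite sets; see
   [finite_reduced_of_disc]. *)
Definition kappa (R : realType) (D : nat) : nat :=
  #|` fset_set (@reduced_of_disc R D)|%fset.

(* Only meaningful for an odd prime [p]. *)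
Definition legendre (a : int) (p : nat) : int :=
  if a%:~R == 0 :> 'F_p then 0
  else if [exists x : 'F_p, x ^+ 2 == a%:~R] then 1 else -1.

Section Checks.
Variable R : realType.
Implicit Types w : R.

Lemma conjugateP w w' (a b c : int) :
  irrational w -> primitive_eq w a b c ->
  conjugate w w' <-> w' = - (b%:~R / a%:~R) - w.
Proof.
move=> wI [a0 _ Ew].
have aR0 : (a%:~R : R) != 0 by rewrite intr_eq0 gt_eqF.
have aQ0 : (a%:~R : rat) != 0 by rewrite intr_eq0 gt_eqF.
pose Q : {poly rat} := a%:~R *: 'X^2 + b%:~R *: 'X + (c%:~R)%:P.
have QE (x : R) : (map_poly ratr Q).[x]
    = a%:~R * x ^+ 2 + b%:~R * x + c%:~R.
  by rewrite /Q !rmorphD/= !map_polyZ/= map_polyXn map_polyX map_polyC/=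
    !ratr_int !hornerE.
have sQ : size Q = 3.
  rewrite /Q -addrA size_polyDl size_scale// size_polyXn//.
  apply: (leq_ltn_trans (size_polyD _ _)); rewrite gtn_max.
  rewrite (leq_ltn_trans (size_scale_leq _ _)) ?size_polyX//=.
  by rewrite (leq_ltn_trans (size_polyC_leq1 _)).
have Qirr : irreducible_poly Q.
  apply: cubic_irreducible; first by rewrite sQ.
  move=> x; apply/negP => rx.
  have /eqP : root (map_poly ratr Q) (ratr x : R) by rewrite fmorph_root.
  rewrite QE => Ex.
  have : (w - ratr x) * (w + ratr x + b%:~R / a%:~R) = 0.
    apply: (mulfI aR0); rewrite mulr0 -[RHS](subrr 0) -{1}Ew -Ex.
    by field.
  move/eqP; rewrite mulf_eq0 => /orP[/eqP h|/eqP h]; apply: wI.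
    by exists x => //; rewrite (subr0_eq h).
  exists (- (x + b%:~R / a%:~R)) => //.
  rewrite rmorphN rmorphD fmorph_div/= !ratr_int.
  by apply/eqP; rewrite -subr_eq0 -opprD oppr_eq0 addrC addrA h.
have rwQ : root (map_poly ratr Q) w by rewrite /root QE Ew.
have facE (x : R) : (map_poly ratr Q).[x]
    = a%:~R * ((x - w) * (x + w + b%:~R / a%:~R)).
  by rewrite QE -[LHS]subr0 -{1}Ew; field.
split=> [[neq [P [Pirr rw rw']]]|->].
  have PQ : (P %| Q)%R.
    have ncop : ~~ coprimep P Q.
      rewrite -(coprimep_map (ratr : {rmorphism rat -> R})).
      by apply/negP => /coprimep_root /(_ rw); rewrite (eqP rwQ) eqxx.
    by rewrite -(eqp_dvdl _ (Pirr.2 _ ncop (dvdp_gcdl _ _))) dvdp_gcdr.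
  have : root (map_poly ratr Q) w'.
    rewrite -dvdp_XsubCl; apply: dvdp_trans (_ : _ %| map_poly ratr P) _.
      by rewrite dvdp_XsubCl.
    by rewrite dvdp_map.
  rewrite /root facE !mulf_eq0 (negPf aR0)/= subr_eq0 => /orP[/eqP//|/eqP h].
  by apply/eqP; rewrite -subr_eq0 -h; apply/eqP; ring.
split.
  move=> h; apply: wI; exists (- (b%:~R / (2 * a%:~R))) => //.
  rewrite rmorphN fmorph_div rmorphM/= !ratr_int ratr_nat.
  have -> : w = (w + w) / 2 by field.
  by rewrite -{1}h; field.
exists Q; split=> //.
by rewrite /root facE; apply/eqP; ring.
Qed.

Lemma has_disc_uniq w (D D' : int) :
  irrational w -> has_disc w D -> has_disc w D' -> D = D'.
Proof.
move=> wI [a [b [c [[a0 g1 E] ->]]]] [a' [b' [c' [[a'0 g1' E'] ->]]]].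
have lin : (a' * b - a * b')%:~R * w + (a' * c - a * c')%:~R = 0.
  rewrite !rmorphB !rmorphM/=.
  transitivity (a'%:~R * (a%:~R * w ^+ 2 + b%:~R * w + c%:~R)
    - a%:~R * (a'%:~R * w ^+ 2 + b'%:~R * w + c'%:~R)); first by ring.
  by rewrite E E' !mulr0 subr0.
have [u0|u0] := eqVneq (a' * b - a * b') 0; last first.
  case: wI; exists (- ((a' * c - a * c')%:~R / (a' * b - a * b')%:~R)) => //.
  rewrite rmorphN fmorph_div/= !ratr_int.
  have uR0 : ((a' * b - a * b')%:~R : R) != 0 by rewrite intr_eq0.
  apply: (mulfI uR0); rewrite mulrN mulrCA divff// mulr1.
  by apply/eqP; rewrite eq_sym -addr_eq0 lin.
have v0 : a' * c - a * c' = 0.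
  by apply/eqP; rewrite -(intr_eq0 R) -lin u0 mul0r add0r.
have dv (x y z x' y' z' : int) : x' * y = x * y' -> x' * z = x * z' ->
    gcdz (gcdz x' y') z' = 1 -> (x' %| x)%Z.
  move=> Ey Ez g.
  have [s [t st]] := Bezoutz x' y'; have [s' [t' st']] := Bezoutz (gcdz x' y') z'.
  apply/dvdzP; exists (s' * (s * x + t * y) + t' * z).
  rewrite -[LHS]mulr1 -g -st' -st.
  transitivity (s' * s * x * x' + s' * t * (x * y') + t' * (x * z')); first by ring.
  by rewrite -Ey -Ez; ring.
have aa' : a = a'.
  have d1 : (a' %| a)%Z by apply: (dv a b c a' b' c') => //; apply/subr0_eq.
  have d2 : (a %| a')%Z.
    by apply: (dv a' b' c' a b c) => //; apply/esym/subr0_eq.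
  move: d1 d2; rewrite !dvdzE => d1 d2.
  have : `|a|%N == `|a'|%N by rewrite eqn_dvd d1 d2.
  by lia.
subst a'; have an0 : a != 0 by rewrite gt_eqF.
by rewrite (mulfI an0 (subr0_eq u0)) (mulfI an0 (subr0_eq v0)).
Qed.

Lemma finite_reduced_of_disc (D : nat) : finite_set (@reduced_of_disc R D).
Proof.
pose f (x : nat * nat) : R := (Num.sqrt D%:R + x.2%:R) / (2 * x.1%:R).
apply: (@sub_finite_set _ _ (f @` (`I_D.+1 `*` `I_D.+1))); last first.
  by apply: finite_image; apply: finite_setX; apply: finite_II.
move=> w [[[wI _] w1 [w' [cw /andP[w'1 w'0]]]] [a [b [c [eqw ED]]]]].
have w'E := (conjugateP _ wI eqw).1 cw.
have [a0 _ Ew] := eqw.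
have aR0 : (0 : R) < a%:~R by rewrite ltr0z.
have an0 : (a%:~R : R) != 0 by rewrite gt_eqF.
have bE : b%:~R = - a%:~R * (w + w') by rewrite w'E; field.
have cE : c%:~R = a%:~R * (w * w').
  transitivity (- a%:~R * w ^+ 2 - b%:~R * w); last by rewrite bE; ring.
  by apply/eqP; rewrite eq_sym -subr_eq0 -oppr_eq0 -Ew; apply/eqP; ring.
have b0 : b < 0.
  by rewrite -(ltrz0 R) bE mulNr oppr_lt0 mulr_gt0//; lra.
have c0 : c < 0.
  by rewrite -(ltrz0 R) cE pmulr_rlt0// pmulr_rlt0//; lra.
exists (`|a|%N, `|b|%N) => /=.
  by split=> /=; nia.
have pa : (`|a|%N%:R : R) = a%:~R by rewrite natr_absz gtr0_norm.
have pb : (`|b|%N%:R : R) = - b%:~R by rewrite natr_absz ltr0_norm// rmorphN.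
have sD : Num.sqrt D%:R = 2 * a%:~R * w + b%:~R.
  have -> : D%:R = (2 * a%:~R * w + b%:~R) ^+ 2 :> R.
    rewrite -[D%:R]/(D%:Z%:~R) ED rmorphB !rmorphM/=.
    by rewrite bE cE; ring.
  have -> : 2 * a%:~R * w + b%:~R = a%:~R * (w - w') by rewrite bE; ring.
  by rewrite sqrtr_sqr ger0_norm// mulr_ge0 ?ltW//; lra.
by rewrite /f/= pa pb sD; field.
Qed.

End Checks.

(* Main.v *)
Require Import Defs.
From mathcomp Require Import all_boot all_order all_algebra finmap finfield.
From mathcomp Require Import all_classical reals.
From mathcomp Require Import ring lra zify.
Import Order.TTheory GRing.Theory Num.Theory.
Local Open Scope ring_scope.

(** Reduced numbers [w] of discriminant [D = pq] correspond to triples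
    [(A, B, C)] of positive integers with [B^2 + 4AC = D] and [|A - C| < B].
    The genus character of such a triple is [(A/p)], or [(-C/p)] if [p] divides
    [A]. Since [-1] is not a square modulo [p], the involution
    [(A, B, C) -> (C, B, A)], i.e. [w -> -1/w'], negates the character, so
    [kappa(D)] is twice the number [N] of triples of character [1]. The
    involution [w -> floor(w) - w'] preserves [A], hence the character, so [N]
    has the parity of the number of its fixed points of character [1]. A fixed
    point satisfies [B = nA], whence [A (A n^2 + 4C) = pq] and [A = 1] or
    [A = p]; each value of [A] occurs exactly once, with characters [1] and
    [-(q/p)] respectively. *)

(** * Parity of fixed points of an involution *)

(** Non-fixed points pair off as [{x, f x}]. The induction removes one such pair, which changes
    neither the fixed points nor the parity. *)
Lemma odd_card_fixed_points {T : choiceType} (A : {fset T}) (f : T -> T) :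
    (forall x, x \in A -> f x \in A) -> (forall x, x \in A -> f (f x) = x) ->
  odd #|` A| = odd #|` [fset x in A | f x == x]%fset|.
Proof.
have [n] := ubnP #|` A|%fset; elim: n A => // n IHn A leAn fA ffA.
have [[x xA fx]|nofix] := pselect (exists2 x, x \in A & f x != x); last first.
  congr (odd #|` _|); apply/fsetP => x; rewrite !inE /=.
  have [xA|//] := boolP (x \in A).
  by apply/esym/negP => /negP fx; apply: nofix; exists x.
have fxA : f x \in (A `\ x)%fset by rewrite !inE fx fA.
pose A' := (A `\ x `\ f x)%fset.
have cardA : #|` A| = (#|` A'|).+2 by rewrite (cardfsD1 x) xA (cardfsD1 (f x)) fxA.
have A'P y : y \in A' -> [/\ y \in A, y != x & y != f x].
  by rewrite !inE => /and3P[].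
rewrite cardA /= negbK IHn.
- congr (odd #|` _|); apply/fsetP => y; rewrite !inE /=.
  have [->|_] := eqVneq y (f x); first by rewrite ffA // [x == f x]eq_sym (negPf fx) !andbF.
  by have [->|_ //] := eqVneq y x; rewrite (negPf fx) !andbF.
- by move: leAn; rewrite cardA; lia.
- move=> y /A'P[yA yx yfx]; rewrite !inE fA // andbT; apply/andP; split.
    by apply: contra yx => /eqP e; rewrite -(ffA y) // e ffA.
  by apply: contra yfx => /eqP <-; rewrite ffA.
- by move=> y /A'P[yA _ _]; apply: ffA.
Qed.

(** * Quadratic residues modulo [p] *)

(** By Euler's criterion, for an odd prime [p] this is the Legendre symbol with values in ['F_p]; as
    a power it is visibly multiplicative. *)
Definition euler {p : nat} (x : 'F_p) : 'F_p := x ^+ p.-1./2.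

Lemma eulerM {p : nat} (x y : 'F_p) : euler (x * y) = euler x * euler y.
Proof. exact: exprMn. Qed.

Lemma euler_sqr {p : nat} {x : 'F_p} :
  prime p -> odd p -> x != 0 -> euler (x ^+ 2) = 1.
Proof.
move=> hp op x0; rewrite /euler -exprM mul2n.
have -> : (p.-1./2.*2 = p.-1)%N by move: op (prime_gt0 hp); lia.
by apply: (mulfI x0); rewrite -exprS prednK ?prime_gt0 // mulr1; have := expf_card x; rewrite card_Fp.
Qed.

Lemma euler_pm1 {p : nat} {x : 'F_p} :
  prime p -> odd p -> x != 0 -> euler x = 1 \/ euler x = -1.
Proof.
move=> hp op x0; have /eqP := euler_sqr hp op x0.
by rewrite expr2 eulerM -expr2 sqrf_eq1 => /orP[/eqP|/eqP]; [left|right].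
Qed.

Lemma mod4_odd_half {p : nat} : (p = 3 %[mod 4])%N -> odd p /\ odd p.-1./2.
Proof. by move=> /=; lia. Qed.

(** The exponent [(p - 1) / 2] is odd. *)
Lemma eulerN {p : nat} (x : 'F_p) : (p = 3 %[mod 4])%N -> euler (- x) = - euler x.
Proof.
by move=> /mod4_odd_half[_ oh]; rewrite /euler exprNn -signr_odd oh expr1 mulN1r.
Qed.

Lemma one_neqN1_Fp {p : nat} : prime p -> odd p -> (1 : 'F_p) != -1.
Proof.
move=> hp op; rewrite -subr_eq0 opprK -[1 + 1]/(2%:R : 'F_p).
rewrite -(dvdn_pcharf (pchar_Fp hp)) (dvdn_prime2 hp) //.
by apply/eqP => e; rewrite e in op.
Qed.

(* For [p = 3 mod 4], a [y] with [euler y = 1] is the square of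
   [y ^+ ((p + 1) / 4)]. *)
Lemma legendreE {p : nat} (a : int) :
    prime p -> (p = 3 %[mod 4])%N -> (a%:~R : 'F_p) != 0 ->
  legendre a p = if euler (a%:~R : 'F_p) == 1 then 1 else -1.
Proof.
move=> hp hp4 a0; have [op oh] := mod4_odd_half hp4.
rewrite /legendre (negPf a0); congr (if _ then _ else _).
apply/existsP/eqP => [[x /eqP ax]|ea].
  by rewrite -ax euler_sqr //; apply: contraNneq a0 => x0; rewrite -ax x0 expr0n.
exists (a%:~R ^+ (p.-1./2.+1)./2); rewrite -exprM muln2.
have -> : ((p.-1./2.+1)./2.*2 = p.-1./2.+1)%N by move: oh; lia.
by rewrite exprS -/(euler _) ea mulr1.
Qed.

(** * Squarefreeness of [pq] *)

(** A prime factor of [d] must be [p] or [q]; cancelling it once makes one of these primes divide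
    the other. *)
Lemma squarefree_mul_primes {p q d : nat} :
  prime p -> prime q -> (p < q)%N -> (d ^ 2 %| p * q)%N -> d = 1%N.
Proof.
move=> hp hq pq dpq; apply/eqP; apply/negPn/negP => d1.
have d0 : (0 < d)%N.
  by case: d dpq {d1} => //; rewrite dvd0n muln_eq0; move: (prime_gt0 hp) (prime_gt0 hq); lia.
have hr : prime (pdiv d) by apply: pdiv_prime; lia.
have rr : (pdiv d ^ 2 %| p * q)%N by apply: dvdn_trans dpq; rewrite dvdn_exp2r ?pdiv_dvd.
have : (pdiv d %| p * q)%N by apply: dvdn_trans rr; rewrite expnS dvdn_mulr.
rewrite (Euclid_dvdM _ _ hr) !dvdn_prime2 // => /orP[] /eqP re; move: rr; rewrite re.
  by rewrite expnS expn1 dvdn_pmul2l ?prime_gt0 // dvdn_prime2 //; lia.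
by rewrite mulnC expnS expn1 dvdn_pmul2l ?prime_gt0 // dvdn_prime2 //; lia.
Qed.

Lemma nonsquare_mul_primes {p q : nat} (x : int) :
  prime p -> prime q -> (p < q)%N -> x ^+ 2 <> (p * q)%N.
Proof.
move=> hp hq pq xpq; have x2 : (`|x| ^ 2 = p * q)%N by rewrite -abszX xpq.
have := @squarefree_mul_primes p q `|x| hp hq pq; rewrite x2 dvdnn => /(_ isT) x1.
by move: x2 (prime_gt1 hp) (prime_gt1 hq); rewrite x1; nia.
Qed.

(** * Reduced forms and their two involutions *)

Definition form := (int * int * int)%type.

(* [(A, B, C)] encodes the root [(B + sqrt D) / (2 A)] of [A x^2 - B x - C];
   [|A - C| < B] is the sign condition at [1] and [-1]. *)
Definition reduced_forms (D : int) : set form :=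
  [set t : form | let: (A, B, C) := t in
    [/\ 0 < A, 0 < C, B ^+ 2 + 4 * A * C = D, A - C < B & C - A < B]]%classic.

Definition form_eval (t : form) (n : int) : int :=
  let: (A, B, C) := t in A * n ^+ 2 - B * n - C.

Definition form_swap (t : form) : form := let: (A, B, C) := t in (C, B, A).

(** For a reduced form the positive root lies strictly between [n] and [n + 1], stated over the
    integers. Strictness is harmless when [D] is not a square, as there is then no integer root. *)
Definition form_floor_spec (t : form) (n : int) : Prop :=
  [/\ 1 <= n, form_eval t n < 0 & 0 < form_eval t (n + 1)].

(** The default 0 is never taken on a reduced form of non-square discriminant. *)
Definition form_floor (t : form) : int := xget 0 [set n | form_floor_spec t n]%classic.

(* With [n] the floor of the root [w], this form has root [n - w']. *)
Definition form_reflect (t : form) : form :=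
  let: (A, B, C) := t in
  (A, 2 * A * form_floor t - B, - form_eval t (form_floor t)).

Lemma form_floor_uniq {D : int} {t : form} {m n : int} :
  reduced_forms D t -> form_floor_spec t m -> form_floor_spec t n -> m = n.
Proof.
have main (k l : int) : reduced_forms D t -> form_floor_spec t k ->
    form_floor_spec t l -> l <= k.
  case: t => [[A B] C]; rewrite /form_floor_spec /= => -[A0 C0 _ _ _] [k1 fk fk1] [l1 fl fl1].
  rewrite leNgt; apply/negP => kl.
  (* Since [C > 0], positivity at [k + 1] gives [A (k + 1) > B], beyond which the polynomial
     increases. The next product is its value at [l] minus its value at [k + 1]. *)
  have : 0 < (k + 1) * (A * (k + 1) - B) by lra.
  rewrite pmulr_rgt0; last by lia.
  move=> inc.
  have : (l - k - 1) * (A * (l + k + 1) - B) < 0 by lra.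
  have : 0 <= l - k - 1 by lia.
  have : 0 < A * (l + k + 1) - B by nia.
  by nia.
by move=> tD mt nt; apply/le_anti; rewrite !main.
Qed.

Lemma form_floorE {D : int} {t : form} {n : int} :
  reduced_forms D t -> form_floor_spec t n -> form_floor t = n.
Proof.
move=> tD nt; rewrite /form_floor; case: xgetP => [m _ mt|/(_ n)//].
exact: form_floor_uniq tD mt nt.
Qed.

Lemma form_floorP {D : int} {t : form} :
  (forall x : int, x ^+ 2 <> D) -> reduced_forms D t ->
  form_floor_spec t (form_floor t).
Proof.
move=> nsq tD; suff [n nt] : exists n, form_floor_spec t n by rewrite (form_floorE tD nt).
case: t tD => [[A B] C] /= [A0 C0 ED AC CA].
pose f (m : nat) := 0 < form_eval (A, B, C) m%:Z.
(* As [A >= 1], the value at [B + C + 1] is at least [(C + 1) (B + C + 1) - C > 0]. *)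
have exf : exists m, f m by exists `|(B + C + 1)%R|%N; rewrite /f /=; nia.
case: (ex_minnP exf) => m; rewrite /f /= => fm minm.
(* The values at 0 and 1 are [- C] and [A - B - C], both negative. *)
have m2 : (2 <= m)%N by case: m fm {minm} => [|[|m]] //; lia.
have fm1 : form_eval (A, B, C) (m%:Z - 1) <= 0.
  rewrite leNgt; apply/negP => fm1.
  have := minm m.-1; rewrite /f /=; have -> : m.-1%:Z = m%:Z - 1 by lia.
  by move=> /(_ fm1); lia.
exists (m%:Z - 1); split; [lia | | by rewrite /= subrK].
rewrite lt_neqAle fm1 andbT; apply/eqP => /= fm0.
(* With [f] the polynomial, [4 A f(x) = (2 A x - B)^2 - D], so an integer root makes [D] a
   square. *)
by apply: (nsq (2 * A * (m%:Z - 1) - B)); lia.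
Qed.

Lemma form_swap_reduced {D : int} {t : form} :
  reduced_forms D t -> reduced_forms D (form_swap t).
Proof. by case: t => [[A B] C] /= [? ? ? ? ?]; split=> //; lia. Qed.

Lemma form_swapK : involutive form_swap.
Proof. by case=> [[A B] C]. Qed.

(** With [f] the polynomial of [t] and [n] its floor, the new sign conditions amount to
    [f(n - 1) < 0] and [f(n + 1) > 0]. *)
Lemma form_reflect_reduced {D : int} {t : form} :
  (forall x : int, x ^+ 2 <> D) -> reduced_forms D t ->
  reduced_forms D (form_reflect t).
Proof.
move=> nsq tD; have := form_floorP nsq tD; rewrite /form_floor_spec /form_reflect.
case: t tD => [[A B] C]; set n := form_floor _ => /= -[A0 C0 ED AC CA] [n1 fn fn1].
split=> //; [lia | by rewrite -ED; ring | | lia].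
(* [f(n - 1) < 0] follows by convexity, interpolating between [f(0) = - C] and [f(n) < 0]. *)
have : n * (A * (n - 1) ^+ 2 - B * (n - 1) - C)
  = (n - 1) * (A * n ^+ 2 - B * n - C) - A * n * (n - 1) - C by ring.
have : 0 <= A * n * (n - 1) by rewrite !mulr_ge0; lia.
have : (n - 1) * (A * n ^+ 2 - B * n - C) <= 0 by nia.
by nia.
Qed.

(** The reflected polynomial is [x -> f(n - x)]. Its values at [n] and [n + 1] are [f(0) = - C < 0]
    and [f(-1) = A + B - C > 0]. *)
Lemma form_floor_reflect {D : int} {t : form} :
  (forall x : int, x ^+ 2 <> D) -> reduced_forms D t ->
  form_floor (form_reflect t) = form_floor t.
Proof.
move=> nsq tD; apply: form_floorE (form_reflect_reduced nsq tD) _.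
have := form_floorP nsq tD; rewrite /form_floor_spec /form_reflect.
case: t tD => [[A B] C]; set n := form_floor _ => /= -[A0 C0 ED AC CA] [n1 fn fn1].
by split=> //=; lia.
Qed.

Lemma form_reflectK {D : int} {t : form} :
  (forall x : int, x ^+ 2 <> D) -> reduced_forms D t ->
  form_reflect (form_reflect t) = t.
Proof.
move=> nsq tD; have := form_floor_reflect nsq tD; rewrite /form_reflect.
case: t tD => [[A B] C] _; set n := form_floor (A, B, C) => /= ->.
by congr (_, _, _); ring.
Qed.

(** * The genus character at [p] *)

(** [A] and [- C] are the values of [A x^2 - B x y - C y^2] at [(1, 0)] and [(0, 1)]; the character
    is the symbol of one that is prime to [p]. *)
Definition genus_char (p : nat) (t : form) : 'F_p :=
  let: (A, _, C) := t in euler (if A%:~R == 0 :> 'F_p then - C%:~R else A%:~R).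

Lemma reduced_form_Fp {p q : nat} {A B C : int} :
    prime p -> reduced_forms (p * q)%N (A, B, C) ->
  B%:~R ^+ 2 + 4%:R * A%:~R * C%:~R = 0 :> 'F_p.
Proof.
move=> hp /= [_ _ ED _ _]; have := congr1 (fun z : int => z%:~R : 'F_p) ED.
by rewrite -[in RHS]pmulrn natrM pchar_Fp_0 // mul0r !rmorphD !rmorphM.
Qed.

(** If [p] divides [A], it divides [B]; if it also divided [C], then [p^2] would divide
    [B^2 + 4AC = pq]. *)
Lemma reduced_form_coprime {p q : nat} {A B C : int} :
    prime p -> prime q -> (p < q)%N -> reduced_forms (p * q)%N (A, B, C) ->
  A%:~R = 0 :> 'F_p -> C%:~R != 0 :> 'F_p.
Proof.
move=> hp hq pq tD A0; apply/negP => /eqP C0.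
have /eqP := reduced_form_Fp hp tD; rewrite A0 mulr0 mul0r addr0 expf_eq0 /=.
move: A0 C0 => /eqP + /eqP; rewrite -!(dvdz_pcharf (pchar_Fp hp)).
move=> /dvdzP[a Aa] /dvdzP[c Cc] /dvdzP[b Bb].
case: tD => _ _ ED _ _; suff p1 : p = 1%N by rewrite p1 in hp.
apply: (squarefree_mul_primes hp hq pq).
suff : ((p ^ 2)%N%:Z %| (p * q)%N%:Z)%Z by rewrite dvdzE.
by apply/dvdzP; exists (b ^+ 2 + 4 * a * c); rewrite -ED Aa Bb Cc !expnS expn0; lia.
Qed.

(** If [p] divides [A] or [C], this is oddness of [euler]. Otherwise [B^2 = - 4AC] modulo [p] is a
    nonzero square, so [A] and [C] have opposite symbols. *)
Lemma genus_char_swap {p q : nat} {t : form} :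
    prime p -> prime q -> (p < q)%N -> (p = 3 %[mod 4])%N ->
    reduced_forms (p * q)%N t ->
  genus_char p (form_swap t) = - genus_char p t.
Proof.
move=> hp hq pq hp4; have [op _] := mod4_odd_half hp4.
case: t => [[A B] C] tD; rewrite /genus_char /form_swap.
have [A0|A0] := eqVneq (A%:~R : 'F_p) 0.
  by rewrite (negPf (reduced_form_coprime hp hq pq tD A0)) eulerN // opprK.
have [C0|C0] := eqVneq (C%:~R : 'F_p) 0; first by rewrite eulerN.
have two0 : (2%:R : 'F_p) != 0.
  by have := one_neqN1_Fp hp op; rewrite -subr_eq0 opprK.
have B2 : (B%:~R : 'F_p) ^+ 2 = - (2%:R ^+ 2 * (A%:~R * C%:~R)).
  by apply/eqP; rewrite -subr_eq0 opprK -(reduced_form_Fp hp tD); apply/eqP; ring.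
have B0 : (B%:~R : 'F_p) != 0.
  apply/negP => /eqP B0; move/eqP: B2; rewrite B0 expr0n eq_sym oppr_eq0.
  by rewrite !mulf_eq0 (negPf two0) (negPf A0) (negPf C0).
have := euler_sqr hp op B0; rewrite B2 eulerN // eulerM euler_sqr // mul1r eulerM.
case: (euler_pm1 hp op A0) => ->; case: (euler_pm1 hp op C0) => ->;
  rewrite ?mulr1 ?mulrN1 ?opprK // => /eqP; rewrite 1?eq_sym (negPf (one_neqN1_Fp hp op)) //.
Qed.

(** [A] is unchanged; if [p] divides [A], it divides [B], and the new last entry [C + B n - A n^2]
    is [C] modulo [p]. *)
Lemma genus_char_reflect {p q : nat} {t : form} :
    prime p -> reduced_forms (p * q)%N t ->
  genus_char p (form_reflect t) = genus_char p t.
Proof.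
case: t => [[A B] C] hp tD; rewrite /genus_char /form_reflect.
set n := form_floor _.
have [A0|//] := eqVneq (A%:~R : 'F_p) 0; congr (euler _).
have /eqP := reduced_form_Fp hp tD; rewrite A0 mulr0 mul0r addr0 expf_eq0 /= => /eqP B0.
by rewrite !(rmorphN, rmorphB, rmorphM) /= A0 B0 !mul0r subrr sub0r opprK.
Qed.

Lemma genus_char_pm1 {p q : nat} {t : form} :
    prime p -> prime q -> (p < q)%N -> odd p -> reduced_forms (p * q)%N t ->
  genus_char p t = 1 \/ genus_char p t = -1.
Proof.
case: t => [[A B] C] hp hq pq op tD; apply: euler_pm1 => //.
have [A0|//] := eqVneq (A%:~R : 'F_p) 0; rewrite oppr_eq0; exact: reduced_form_coprime tD A0.
Qed.

(** * Forms fixed by the reflection *)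

(** The floor is [n]: the values at [n] and [n + 1] are [- C] and [A (n + 1) - C]. *)
Lemma form_reflect_fixed {A n C : int} {D : int} :
  0 < n -> reduced_forms D (A, A * n, C) -> form_reflect (A, A * n, C) = (A, A * n, C).
Proof.
move=> n0 tD; have [A0 C0 _ AC CA] := tD.
rewrite /form_reflect (form_floorE (n := n) tD); first by rewrite /=; congr (_, _, _); ring.
by rewrite /form_floor_spec /=; split; lia.
Qed.

Lemma form_reflect_fixedP {D : int} {A B C : int} :
    (forall x : int, x ^+ 2 <> D) -> reduced_forms D (A, B, C) ->
    form_reflect (A, B, C) = (A, B, C) ->
  exists2 n : int, 0 < n & B = A * n.
Proof.
move=> nsq tD [] EB _; have [n1 _ _] := form_floorP nsq tD.
by exists (form_floor (A, B, C)); lia.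
Qed.

(** Oddness of [D] makes [n] odd, while [C > 0] and [C - A < A n] give
    [(A n)^2 < D < (A (n + 2))^2]. Only one odd [n] fits, and [D] then determines [C]. *)
Lemma fixed_form_uniq {D : int} {A n m C C' : int} :
    (forall x : int, D <> 2 * x) ->
    reduced_forms D (A, A * n, C) -> reduced_forms D (A, A * m, C') -> 0 < n -> 0 < m ->
  (A, A * n, C) = (A, A * m, C').
Proof.
move=> oD tn tm n0 m0.
have odd_mult k E : reduced_forms D (A, A * k, E) -> forall j : int, k <> 2 * j.
  move=> /= [_ _ ED _ _] j kj; apply: (oD (2 * (A * j) ^+ 2 + 2 * A * E)).
  by rewrite -ED kj; ring.
have main k l E E' : reduced_forms D (A, A * k, E) -> reduced_forms D (A, A * l, E') ->
    0 < k -> 0 < l -> l <= k.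
  move=> tk tl k0 l0; rewrite leNgt; apply/negP => kl.
  have kl2 : k + 2 <= l.
    have := odd_mult _ _ tk; have := odd_mult _ _ tl => ol ok.
    have [//|lk] := leP (k + 2) l; have lk1 : l = k + 1 by lia.
    have := ok (k %/ 2)%Z; have := ol (l %/ 2)%Z; lia.
  case: tk tl => A0 E0 ED _ EA [_ E'0 ED' _ _].
  have : D < (A * (k + 2)) ^+ 2 by rewrite -ED; nia.
  have : (A * (k + 2)) ^+ 2 <= (A * l) ^+ 2 by rewrite lerXn2r ?nnegrE ?mulr_ge0 ?ler_pM2l; lia.
  by have : 0 < A * E' by [rewrite mulr_gt0]; lia.
have nm : n = m.
  by apply/le_anti/andP; split; [exact: main tm tn _ _ | exact: main tn tm _ _].
move: tn tm => [A0 _ ED _ _] [_ _ ED' _ _]; rewrite -nm in ED' *; congr (_, _, _).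
by apply: (@mulfI _ (4 * A)); lia.
Qed.

(** It suffices to find an odd [n = 2k + 1] with [A n^2 < A + 4e < A (n + 2)^2]; the least [k]
    satisfying the right inequality works. Equality on the left would make [A (A + 4e)] the square
    of [A n]. *)
Lemma fixed_form_exists {A e : int} :
    0 < A -> 0 < e -> (forall x : int, x ^+ 2 <> A * (A + 4 * e)) ->
  exists n C : int, [/\ 0 < n, reduced_forms (A * (A + 4 * e)) (A, A * n, C)
    & A * n ^+ 2 + 4 * C = A + 4 * e].
Proof.
move=> A0 e0 nsq; pose f (k : nat) := A + 4 * e < A * (2 * k%:Z + 3) ^+ 2.
have exf : exists k, f k by exists `|e|%N; rewrite /f; nia.
case: (ex_minnP exf) => k fk mink; rewrite /f in fk mink.
have lek : A * (2 * k%:Z + 1) ^+ 2 < A + 4 * e.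
  have [->|k0] := eqVneq k 0%N; first by rewrite mulr0 add0r expr1n; lia.
  rewrite lt_neqAle; apply/andP; split.
    by apply/eqP => E; apply: (nsq (A * (2 * k%:Z + 1))); rewrite -E; ring.
  rewrite leNgt; apply/negP => lt; have := mink k.-1.
  have -> : 2 * k.-1%:Z + 3 = 2 * k%:Z + 1 by lia.
  by move=> /(_ lt); lia.
exists (2 * k%:Z + 1), (e - A * k%:Z * (k%:Z + 1)); split; [lia | | ring].
split=> //; [lia | ring | nia | lia].
Qed.

(** * Reduced quadratic numbers as roots of reduced forms *)

Lemma sqrt_irrational {R : realType} {D : nat} :
  (forall x : int, x ^+ 2 <> D) -> irrational (Num.sqrt D%:R : R).
Proof.
move=> nsq [r _ rD]; have r2 : r ^+ 2 = D%:R.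
  apply: (fmorph_inj (ratr : {rmorphism rat -> R})); rewrite rmorphXn /= rD sqr_sqrtr ?ler0n //.
  by rewrite -[RHS]/(ratr _) rmorph_nat.
have den0 : (denq r)%:~R != 0 :> rat by rewrite intr_eq0 denq_neq0.
have E : numq r ^+ 2 = D%:Z * denq r ^+ 2.
  apply: (@intr_inj rat); rewrite [in RHS]rmorphM !rmorphXn /= -pmulrn -r2 -exprMn.
  by rewrite -{2}(divq_num_den r) divfK.
apply: (nsq (numq r)); rewrite E; suff -> : denq r = 1 by rewrite expr1n mulr1.
have : (`|denq r| ^ 2 %| `|numq r| ^ 2)%N.
  by rewrite -!abszX E abszM dvdn_mull.
rewrite dvdn_pexp2r // => dn; have := coprime_num_den r.
by rewrite coprime_sym /coprime (gcdn_idPl dn); have := denq_gt0 r; lia.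
Qed.

Definition form_root (R : realType) (D : nat) (t : form) : R :=
  let: (A, B, _) := t in (Num.sqrt D%:R + B%:~R) / (2 * A%:~R).

(** Clearing denominators gives [(A' - A) sqrt D = A B' - A' B]; irrationality forces [A = A'], then
    [B = B'], and [D] determines [C]. *)
Lemma form_root_inj {R : realType} {D : nat} :
  (forall x : int, x ^+ 2 <> D) ->
  {in reduced_forms D &, injective (form_root R D)}%classic.
Proof.
move=> nsq [[A B] C] [[A' B'] C'] /set_mem[A0 C0 ED _ _] /set_mem[A'0 C'0 ED' _ _] /= E.
have aR : (A%:~R : R) != 0 by rewrite intr_eq0 gt_eqF.
have aR' : (A'%:~R : R) != 0 by rewrite intr_eq0 gt_eqF.
have lin : Num.sqrt D%:R * (A' - A)%:~R = (A * B' - A' * B)%:~R :> R.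
  rewrite !rmorphB !rmorphM /=.
  have : 2 * A%:~R * A'%:~R * ((Num.sqrt D%:R + B%:~R) / (2 * A%:~R))
    = 2 * A%:~R * A'%:~R * ((Num.sqrt D%:R + B'%:~R) / (2 * A'%:~R)) :> R by rewrite E.
  have -> : 2 * A%:~R * A'%:~R * ((Num.sqrt D%:R + B%:~R) / (2 * A%:~R))
    = A'%:~R * (Num.sqrt D%:R + B%:~R) :> R by field.
  have -> : 2 * A%:~R * A'%:~R * ((Num.sqrt D%:R + B'%:~R) / (2 * A'%:~R))
    = A%:~R * (Num.sqrt D%:R + B'%:~R) :> R by field.
  by lra.
have AA : A = A'.
  have [//|neqA] := eqVneq A A'; case: (sqrt_irrational (R := R) nsq).
  have dR : ((A' - A)%:~R : R) != 0 by rewrite intr_eq0 subr_eq0 eq_sym.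
  exists ((A * B' - A' * B)%:~R / (A' - A)%:~R) => //.
  by rewrite fmorph_div /= !ratr_int -lin mulfK.
have BB : B = B'.
  move: lin; rewrite AA subrr mulr0 => /esym/eqP.
  rewrite intr_eq0 -mulrBr mulf_eq0 (gt_eqF A'0) /= subr_eq0 => /eqP ->.
  by [].
by rewrite -AA -BB in ED' *; congr (_, _, _); apply: (@mulfI _ (4 * A)); lia.
Qed.

Lemma image_form_root {R : realType} {D : nat} :
    (forall x : int, x ^+ 2 <> D) -> (forall d : nat, (d ^ 2 %| D)%N -> d = 1%N) ->
  (form_root R D @` reduced_forms D = @reduced_of_disc R D)%classic.
Proof.
move=> nsq sqf; apply/seteqP; split=> [w [[[A B] C] tD <-]|w].
  have [A0 C0 ED AC CA] := tD; rewrite /form_root.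
  set s : R := Num.sqrt D%:R; set w0 := _ / _.
  have aR : (0 : R) < A%:~R by rewrite ltr0z.
  have an : (A%:~R : R) != 0 by rewrite gt_eqF.
  have cR : (0 : R) < C%:~R by rewrite ltr0z.
  have s2 : s ^+ 2 = B%:~R ^+ 2 + 4 * A%:~R * C%:~R.
    rewrite sqr_sqrtr ?ler0n // -[D%:R]/(D%:Z%:~R) -ED.
    by rewrite rmorphD !rmorphM.
  have s0 : 0 < s.
    rewrite lt_neqAle sqrtr_ge0 andbT eq_sym; apply/eqP => s0.
    by move: s2; rewrite s0; nra.
  have sE : s = 2 * A%:~R * w0 - B%:~R by rewrite /w0; field.
  have Ew : A%:~R * w0 ^+ 2 + (- B)%:~R * w0 + (- C)%:~R = 0.
    apply: (@mulfI _ (4 * A%:~R)); first by rewrite mulf_neq0 // pnatr_eq0.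
    by rewrite !rmorphN /=; move: s2; rewrite sE => s2; lra.
  have wI : irrational w0.
    move=> [r _ rw]; apply: (sqrt_irrational (R := R) nsq).
    exists (2 * A%:~R * r - B%:~R) => //.
    by rewrite rmorphB !rmorphM /= !ratr_int ratr_nat rw -sE.
  have peq : primitive_eq w0 A (- B) (- C).
    split=> //; set g := gcdz _ _.
    have gC : (g %| C)%Z by rewrite -rpredN dvdz_gcdr.
    have gAB : (g %| gcdz A (- B))%Z by exact: dvdz_gcdl.
    have gA : (g %| A)%Z by apply: dvdz_trans gAB (dvdz_gcdl _ _).
    have gB : (g %| B)%Z by rewrite -rpredN; apply: dvdz_trans gAB (dvdz_gcdr _ _).
    (* The square of a common divisor of [A], [B], [C] divides [D], which is squarefree. *)
    suff g1 : `|g|%N = 1%N by rewrite -[g]/((`|g|%N)%:Z) g1.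
    apply: sqf; suff : (g ^+ 2 %| D%:Z)%Z by rewrite dvdzE abszX.
    move/dvdzP: gA => [a Aa]; move/dvdzP: gB => [b Bb]; move/dvdzP: gC => [c Cc].
    apply/dvdzP; exists (b ^+ 2 + 4 * a * c).
    by rewrite -ED [in LHS]Aa [in LHS]Bb [in LHS]Cc; ring.
  split; last by exists A, (- B), (- C); split=> //; rewrite -ED; ring.
  pose w' : R := (B%:~R - s) / (2 * A%:~R).
  have wD : 2 * A%:~R * w' = B%:~R - s by rewrite /w'; field.
  have wS : A%:~R * (w0 + w') = B%:~R by rewrite /w' /w0; field.
  have wP : A%:~R * (w0 * w') = - C%:~R.
    apply: (@mulfI _ (4 * A%:~R)); first by rewrite mulf_neq0 // pnatr_eq0.
    transitivity (B%:~R ^+ 2 - s ^+ 2); first by rewrite /w' /w0; field.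
    by rewrite s2; ring.
  have w'w : w' < w0 by rewrite -(ltr_pM2l aR); lra.
  have [ACR CAR] : A%:~R - C%:~R < B%:~R :> R /\ C%:~R - A%:~R < B%:~R :> R.
    by rewrite -!rmorphB /= !ltr_int.
  (* The signs of the polynomial at 0, 1 and -1, factored through its roots, give in turn [w' < 0],
     [w0 > 1] and [w' > -1]. *)
  have w'0 : w' < 0.
    rewrite ltNge; apply/negP => h.
    have : 0 <= A%:~R * (w0 * w') by apply: mulr_ge0; [exact: ltW | apply: mulr_ge0; lra].
    by lra.
  have w1 : 1 < w0.
    have : A%:~R * ((1 - w') * (1 - w0)) < 0 by lra.
    by rewrite !pmulr_rlt0; lra.
  have w'1 : -1 < w'.
    have : 0 < A%:~R * ((1 + w0) * (1 + w')) by lra.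
    by rewrite !pmulr_rgt0; lra.
  split=> //.
    split=> //; exists (Poly [:: - C; - B; A]); split.
      by rewrite (@PolyK _ 0) //= gt_eqF.
    apply/eqP; rewrite -[RHS]Ew.
    rewrite [Poly _]/= !cons_poly_def.
    rewrite !(rmorphD, rmorphM) /= !map_polyX !map_polyC /= rmorph0 !hornerE.
    by rewrite /=; ring.
  exists w'; split; last by rewrite w'1 w'0.
  by apply/(conjugateP _ wI peq); rewrite rmorphN /= mulNr opprK -wS; field.
move=> [[[wI _] w1 [w' [cw /andP[w'1 w'0]]]] [a [b [c [eqw ED]]]]].
have w'E := (conjugateP _ wI eqw).1 cw.
have [a0 _ Ew] := eqw.
have aR : (0 : R) < a%:~R by rewrite ltr0z.
have an : (a%:~R : R) != 0 by rewrite gt_eqF.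
have bE : b%:~R = - (a%:~R * (w + w')) by rewrite w'E; field.
have cE : c%:~R = a%:~R * (w * w').
  transitivity (a%:~R * (w * w') + (a%:~R * w ^+ 2 + b%:~R * w + c%:~R)).
    by rewrite bE; ring.
  by rewrite Ew addr0.
exists (a, - b, - c) => /=.
  have c0 : c < 0.
    by rewrite -(ltrz0 R) cE pmulr_rlt0 // pmulr_rlt0 //; lra.
  (* These two products are [- (a + b + c)] and [a - b + c]. *)
  have e1 : a%:~R * ((w - 1) * (1 - w')) > 0 by rewrite !mulr_gt0 //; lra.
  have e2 : a%:~R * ((1 + w) * (1 + w')) > 0 by rewrite !mulr_gt0 //; lra.
  have h1 : ((a + b + c)%:~R : R) < 0.
    by rewrite !rmorphD /= bE cE; lra.
  have h2 : (0 : R) < (a - b + c)%:~R.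
    by rewrite !(rmorphD, rmorphN) /= bE cE; lra.
  rewrite ltrz0 in h1; rewrite ltr0z in h2.
  by split=> //; [lia | rewrite ED; ring | lia | lia].
have -> : Num.sqrt D%:R = 2 * a%:~R * w + b%:~R :> R.
  have -> : D%:R = (2 * a%:~R * w + b%:~R) ^+ 2 :> R.
    by rewrite -[D%:R]/(D%:Z%:~R) ED rmorphB !rmorphM /= bE cE; ring.
  have -> : 2 * a%:~R * w + b%:~R = a%:~R * (w - w') by rewrite bE; ring.
  by rewrite sqrtr_sqr ger0_norm // mulr_ge0 ?ltW //; lra.
by rewrite rmorphN /=; field.
Qed.

Lemma finite_reduced_forms (D : nat) : finite_set (reduced_forms D).
Proof.
pose f (x : nat * nat * nat) : form := (x.1.1%:Z, x.1.2%:Z, x.2%:Z).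
apply: (@sub_finite_set _ _ (f @` (`I_D.+1 `*` `I_D.+1 `*` `I_D.+1)))%classic; last first.
  by apply: finite_image; do 2!apply: finite_setX => //; apply: finite_II.
move=> [[A B] C] [A0 C0 ED AC CA]; exists (`|A|%N, `|B|%N, `|C|%N); last first.
  by rewrite /f /= !gez0_abs //; lia.
have AC0 : 0 < A * C by rewrite mulr_gt0.
have B2 : 0 <= B ^+ 2 by rewrite sqr_ge0.
by split; [split|] => /=; nia.
Qed.

Lemma kappaE {R : realType} {D : nat} :
    (forall x : int, x ^+ 2 <> D) -> (forall d : nat, (d ^ 2 %| D)%N -> d = 1%N) ->
  kappa R D = #|` fset_set (reduced_forms D)|%fset.
Proof.
move=> nsq sqf; have fin := finite_reduced_forms D.
rewrite /kappa -(image_form_root nsq sqf) fset_set_image //.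
rewrite card_in_imfset //= => x y; rewrite !in_fset_set // => xD yD.
exact: form_root_inj.
Qed.

(** * The count for [D = pq] *)

(** [A (A n^2 + 4C) = pq]. Since [A >= q] would give [A^2 n^2 >= q^2 > pq], [A] is prime to [q] and
    so divides [p]. *)
Lemma fixed_form_lead {p q : nat} {A n C : int} :
    prime p -> prime q -> (p < q)%N -> 0 < n ->
    reduced_forms (p * q)%N (A, A * n, C) ->
  A = 1 \/ A = p%:Z.
Proof.
move=> hp hq pq n0 [A0 C0 ED _ _].
have AE : (A * (A * n ^+ 2 + 4 * C) = (p * q)%N%:Z) by rewrite -ED; ring.
have Aq : (`|A| < q)%N.
  rewrite ltnNge; apply/negP => qA; have : q%:Z <= A by lia.
  move=> {}qA; have : (p * q)%N%:Z < q%:Z * q%:Z by have := prime_gt0 hq; nia.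
  have : A * A <= A * (A * n ^+ 2) by rewrite ler_pM2l // ler_peMr ?exprn_ege1; lia.
  have : 0 < A * C by rewrite mulr_gt0.
  have : q%:Z * q%:Z <= A * A by rewrite ler_pM.
  by lia.
have : (`|A| %| p * q)%N.
  by have : (A %| (p * q)%N%:Z)%Z; [rewrite -AE dvdz_mulr | rewrite dvdzE].
rewrite Gauss_dvdl; last first.
  rewrite coprime_sym prime_coprime //; apply/negP => /dvdn_leq; lia.
case/primeP: hp => _ /[apply] /orP[] /eqP e; [left | right]; lia.
Qed.

Lemma odd_mul_primes {p q : nat} : (p = 3 %[mod 4])%N -> (q = 3 %[mod 4])%N ->
  forall x : int, ((p * q)%N : int) <> 2 * x.
Proof.
move=> /mod4_odd_half[op _] /mod4_odd_half[oq _] x E.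
by have : odd (p * q) by [rewrite oddM op]; lia.
Qed.

(** The swap maps the forms of character 1 bijectively onto those of character -1, while the
    reflection acts on [P]. *)
Lemma card_reduced_forms {p q : nat} (F : {fset form})
    (P := [fset t in F | genus_char p t == 1]%fset) :
    prime p -> prime q -> (p < q)%N -> (p = 3 %[mod 4])%N ->
    (forall t, t \in F <-> reduced_forms (p * q)%N t) ->
  (#|` F| = 2 * #|` P| /\
   odd #|` P| = odd #|` [fset t in P | form_reflect t == t]|)%fset%N.
Proof.
move=> hp hq pq hp4 FP; have [op _] := mod4_odd_half hp4.
have nsq x := @nonsquare_mul_primes p q x hp hq pq.
split; last first.
  apply: odd_card_fixed_points => t; rewrite !inE => /andP[/FP tF /eqP gt].
    by apply/andP; split; [apply/FP/form_reflect_reduced | rewrite (genus_char_reflect hp tF) gt].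
  exact: form_reflectK.
rewrite -(cardfsID P F) (_ : (F `&` P = P)%fset); last first.
  by apply/fsetP => t; rewrite !inE /= andbA andbb.
rewrite mul2n -addnn; congr addn.
have <- : #|` (form_swap @` P)|%fset = #|` P|%fset.
  by rewrite card_imfset //; exact: inv_inj form_swapK.
congr (#|` _|)%fset.
apply/fsetP => t; apply/idP/imfsetP => /= [|[u + ->]]; rewrite !inE /=.
  rewrite andbC negb_and; case: (boolP (t \in F)) => //= /FP tF gt.
  exists (form_swap t); last by rewrite form_swapK.
  rewrite !inE (genus_char_swap hp hq pq hp4 tF).
  apply/andP; split; first by apply/FP/form_swap_reduced.
  by case: (genus_char_pm1 hp hq pq op tF) gt => ->; rewrite ?eqxx // opprK.
move=> /andP[/FP uF /eqP gu].
rewrite (genus_char_swap hp hq pq hp4 uF) gu eq_sym (negPf (one_neqN1_Fp hp op)) andbF /=.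
by apply/FP/form_swap_reduced.
Qed.

Theorem theorem3p12 (R : realType) (p q : nat)
    (hp : prime p) (hq : prime q) (hpq : (p < q)%N)
    (hp4 : (p = 3 %[mod 4])%N) (hq4 : (q = 3 %[mod 4])%N) :
  ((kappa R (p * q))%:Z = 1 + legendre q%:Z p %[mod 4])%Z.
Proof.
have [op _] := mod4_odd_half hp4.
have nsq x := @nonsquare_mul_primes p q x hp hq hpq.
have sqf d := @squarefree_mul_primes p q d hp hq hpq.
have fin := finite_reduced_forms (p * q).
rewrite kappaE //; set F := fset_set _.
have FP t : t \in F <-> reduced_forms (p * q)%N t.
  by rewrite in_fset_set //; split => [/set_mem|/mem_set].
have [-> oddP] := card_reduced_forms F hp hq hpq hp4 FP.
set P := [fset t in F | _]%fset in oddP *.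
have q0 : (q%:~R : 'F_p) != 0.
  by rewrite -(dvdz_pcharf (pchar_Fp hp)) dvdzE /= dvdn_prime2 // ltn_eqF.
have [e e0 pqE] : exists2 e : int, 0 < e & (p * q)%N%:Z = 1 + 4 * e.
  have [u pu] : exists u, (p = 4 * u + 3)%N by exists (p %/ 4)%N; lia.
  have [v qv] : exists v, (q = 4 * v + 3)%N by exists (q %/ 4)%N; lia.
  exists (4 * u * v + 3 * u + 3 * v + 2)%N; first by rewrite ltz_nat addn2.
  by rewrite pu qv !(PoszD, PoszM); ring.
have [n1 [C1 [n10 D1 E1]]] : exists n C : int,
    [/\ 0 < n, reduced_forms (p * q)%N (1, 1 * n, C) & 1 * n ^+ 2 + 4 * C = (p * q)%N].
  have := @fixed_form_exists 1 e; rewrite -pqE [1 * _%:Z]mul1r; exact.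
(* Here [e = (q - p) / 4], so that [p (p + 4e) = pq]. *)
have [n2 [C2 [n20 D2 E2]]] : exists n C : int,
    [/\ 0 < n, reduced_forms (p * q)%N (p%:Z, p%:Z * n, C) & p%:Z * n ^+ 2 + 4 * C = q].
  have qE : p%:Z + 4 * ((q - p) %/ 4)%N%:Z = q%:Z by lia.
  have := @fixed_form_exists p%:Z ((q - p) %/ 4)%N%:Z; rewrite qE.
  by apply; [have := prime_gt0 hp; lia | lia |].
have fix_lead t : reduced_forms (p * q)%N t -> form_reflect t = t ->
    t = (1, 1 * n1, C1) \/ t = (p%:Z, p%:Z * n2, C2).
  case: t => [[A B] C] tD /(form_reflect_fixedP nsq tD)[n n0 BE]; rewrite BE in tD *.
  have oD := odd_mul_primes hp4 hq4.
  have lead := fixed_form_lead hp hq hpq n0 tD.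
  case: lead tD => -> tD; [left | right];
    exact: fixed_form_uniq oD tD _ n0 _.
have g1 : genus_char p (1, 1 * n1, C1) = 1.
  by rewrite /genus_char oner_eq0 /euler expr1n.
have g2 : genus_char p (p%:Z, p%:Z * n2, C2) = - euler (q%:~R : 'F_p).
  (* As [p] divides the leading entry, the character is the symbol of [- C2], and [4 C2 = q] modulo
     [p] with 4 a square. *)
  rewrite /genus_char -pmulrn pchar_Fp_0 // eqxx eulerN // -E2.
  rewrite rmorphD !rmorphM /= -pmulrn pchar_Fp_0 // mul0r add0r.
  have -> : 4%:~R = 2%:R ^+ 2 :> 'F_p by rewrite -natrX.
  rewrite eulerM euler_sqr ?mul1r //.
  by have := one_neqN1_Fp hp op; rewrite -subr_eq0 opprK.
have neq : ((1, 1 * n1, C1) : form) != (p%:Z, p%:Z * n2, C2).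
  by apply/eqP => -[p1 _ _]; have := prime_gt1 hp; lia.
rewrite legendreE //.
(* If [(q/p) = 1], only the form with [A = 1] has character 1, so [#|P|] is odd and [2 #|P| = 2]
   modulo 4. If [(q/p) = -1], both fixed forms count and [2 #|P| = 0] modulo 4. *)
have [eq1|eqN1] := euler_pm1 hp op q0.
  rewrite eq1 eqxx; suff fixE :
      [fset t in P | form_reflect t == t]%fset = [fset (1, 1 * n1, C1)]%fset.
    by move: oddP; rewrite fixE cardfs1; lia.
  apply/fsetP => t; rewrite !inE; apply/idP/eqP => [/andP[/andP[/FP tF gt] /eqP ft]|->].
    case: (fix_lead _ tF ft) => // tE; move: gt.
    by rewrite tE g2 eq1 eq_sym (negPf (one_neqN1_Fp hp op)).
  by rewrite g1 (form_reflect_fixed n10 D1) !eqxx !andbT; apply/FP.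
rewrite eqN1 eq_sym (negPf (one_neqN1_Fp hp op)).
suff fixE : [fset t in P | form_reflect t == t]%fset
    = [fset (1, 1 * n1, C1); (p%:Z, p%:Z * n2, C2)]%fset.
  by move: oddP; rewrite fixE cardfs2 neq; lia.
apply/fsetP => t; rewrite !inE; apply/idP/orP => [/andP[/andP[/FP tF gt] /eqP ft]|].
  by case: (fix_lead _ tF ft) => ->; [left | right].
case=> /eqP ->; rewrite ?g1 ?g2 ?eqN1 ?opprK eqxx
  1?(form_reflect_fixed n10 D1) 1?(form_reflect_fixed n20 D2) eqxx !andbT; exact/FP.
Qed.
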